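(* Let $\mathfrak g=\mathfrak h\oplus\mathfrak k$ be a semidirect product Lie algebra, with $\mathfrak h$ a subalgebra and $\mathfrak k$ an ideal, and let $j:\mathfrak h\to\mathfrak k$ be any linear isomorphism. Define linear maps on $\mathfrak g$ by $$J(x,v)=(-j^{-1}v,jx),\quad E(x,v)=(j^{-1}v,jx),\quad F(x,v)=(x,-v)\qquad(x\in\mathfrak h,\ v\in\mathfrak k).$$ Then the following statements are equivalent: (1) there exists a torsion-free connection $\nabla$ on $\mathfrak g$ such that $\nabla F=0$ and $\nabla J=0$; (2) there exists a torsion-free connection $\nabla$ on $\mathfrak g$ such that $\nabla F=0$ and $\nabla E=0$; (3) there exists a torsion-free connection $\nabla$ on $\mathfrak g$ such that $\nabla E=0$ and $\nabla J=0$; (4) $J$ is integrable; (5) $E$ is integrable. In any of the cases (1), (2), (3), such a connection is unique and flat.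
   Context: All Lie algebras are real and finite-dimensional. A semidirect product Lie algebra $\mathfrak g=\mathfrak h\oplus\mathfrak k$ is a vector space direct sum of a Lie subalgebra $\mathfrak h$ and an ideal $\mathfrak k$; its bracket is $[x,y]=[x,y]_{\mathfrak h}$, $[x,v]=\pi(x)v$, $[u,v]=[u,v]_{\mathfrak k}$ for $x,y\in\mathfrak h$, $u,v\in\mathfrak k$, where $\pi:\mathfrak h\to\operatorname{End}(\mathfrak k)$ is a representation acting by derivations of $\mathfrak k$. A connection on $\mathfrak g$ is a bilinear map $\nabla:\mathfrak g\times\mathfrak g\to\mathfrak g$, $(X,Y)\mapsto\nabla_XY$. It is torsion-free if $\nabla_XY-\nabla_YX=[X,Y]$ for all $X,Y$, and flat if $\nabla_X\nabla_YZ-\nabla_Y\nabla_XZ-\nabla_{[X,Y]}Z=0$ for all $X,Y,Z\in\mathfrak g$. For a linear map $S:\mathfrak g\to\mathfrak g$, $\nabla S=0$ means $\nabla_X(SY)=S(\nabla_XY)$ for all $X,Y\in\mathfrak g$. $J$ is integrable if $[JY,JZ]-[Y,Z]-J[JY,Z]-J[Y,JZ]=0$ for all $Y,Z\in\mathfrak g$; $E$ is integrable if $[EY,EZ]+[Y,Z]-E[EY,Z]-E[Y,EZ]=0$ for all $Y,Z\in\mathfrak g$. *)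

(* Defs.v *)
From HB Require Import structures.
From mathcomp Require Import all_boot all_order all_algebra.
From mathcomp Require Import sesquilinear reals.

Set Implicit Arguments.
Unset Strict Implicit.
Unset Printing Implicit Defensive.

Import GRing.Theory.
Local Open Scope ring_scope.

HB.mixin Record isLieAlgebra (K : fieldType) L & Vector K L := {
  lie_bracket : {bilinear L -> L -> L};
  lie_alt : forall x : L, lie_bracket x x = 0;
  lie_jacobi : forall x y z : L,
    lie_bracket x (lie_bracket y z) + lie_bracket y (lie_bracket z x)
      + lie_bracket z (lie_bracket x y) = 0
}.

#[short(type="lieAlgType")]
HB.structure Definition LieAlgebra (K : fieldType) :=
  { L of isLieAlgebra K L & Vector K L }.

Notation "[ 'lie' x , y ]" := (lie_bracket x y)
  (at level 0, format "[ 'lie'  x ,  y ]") : ring_scope.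

Section SemidirectProduct.
Variables (K : fieldType) (L : lieAlgType K).
Implicit Types h k : {vspace L}.

Definition lie_subalgebra h := forall x y, x \in h -> y \in h -> [lie x, y] \in h.

Definition lie_ideal k := forall x v, v \in k -> [lie x, v] \in k.

(* The representation of h on k by derivations is x |-> [lie x, _]. *)
Definition semidirect_product h k :=
  [/\ (h + k)%VS = fullv, (h :&: k)%VS = 0%VS, lie_subalgebra h & lie_ideal k].

End SemidirectProduct.

Section StructureMaps.
Variables (K : fieldType) (L : lieAlgType K) (h k : {vspace L}).
Variable j : 'Hom(subvs_of h, subvs_of k).

(* The coordinates (x, v) of an element of h (+) k; they are meaningful only
   when h and k are complementary. *)
Definition coord_h : 'Hom(L, subvs_of h) :=
  (linfun (vsproj h) \o daddv_pi h k)%VF.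
Definition coord_k : 'Hom(L, subvs_of k) :=
  (linfun (vsproj k) \o daddv_pi k h)%VF.
Definition incl_h : 'Hom(subvs_of h, L) := linfun vsval.
Definition incl_k : 'Hom(subvs_of k, L) := linfun vsval.

(* (j^-1)%VF is the inverse of j as soon as j is bijective. *)
Definition mapJ : 'End(L) :=
  (incl_k \o j \o coord_h)%VF - (incl_h \o j^-1 \o coord_k)%VF.
Definition mapE : 'End(L) :=
  (incl_k \o j \o coord_h)%VF + (incl_h \o j^-1 \o coord_k)%VF.
Definition mapF : 'End(L) :=
  (incl_h \o coord_h)%VF - (incl_k \o coord_k)%VF.

Hypothesis dhk : (h :&: k)%VS = 0%VS.
Implicit Types (x : subvs_of h) (v : subvs_of k).

Lemma daddv_pi0 (U V : {vspace L}) u :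
  (U :&: V)%VS = 0%VS -> u \in V -> daddv_pi U V u = 0.
Proof.
move=> UV uV; have VU : (V :&: U)%VS = 0%VS by rewrite capvC.
have := daddv_pi_add UV (subvP (addvSr U V) _ uV).
by rewrite (daddv_pi_id VU uV) => /(canRL (addrK _)); rewrite subrr.
Qed.

Lemma coord_hE x v : coord_h (vsval x + vsval v) = x.
Proof.
rewrite comp_lfunE lfunE /= linearD /= daddv_pi_id ?subvsP //.
by rewrite daddv_pi0 ?subvsP // addr0 vsvalK.
Qed.

Lemma coord_kE x v : coord_k (vsval x + vsval v) = v.
Proof.
have dkh : (k :&: h)%VS = 0%VS by rewrite capvC.
rewrite comp_lfunE lfunE /= linearD /= (daddv_pi0 dkh) ?subvsP //.
by rewrite daddv_pi_id ?subvsP // add0r vsvalK.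
Qed.

Lemma mapJE x v :
  mapJ (vsval x + vsval v) = vsval (- (j^-1)%VF v) + vsval (j x).
Proof.
rewrite add_lfunE opp_lfunE 2!comp_lfunE coord_hE 2!comp_lfunE coord_kE.
by rewrite !lfunE addrC -linearN.
Qed.

Lemma mapEE x v :
  mapE (vsval x + vsval v) = vsval ((j^-1)%VF v) + vsval (j x).
Proof.
rewrite add_lfunE 2!comp_lfunE coord_hE 2!comp_lfunE coord_kE.
by rewrite !lfunE addrC.
Qed.

Lemma mapFE x v : mapF (vsval x + vsval v) = vsval x + vsval (- v).
Proof.
rewrite add_lfunE opp_lfunE comp_lfunE coord_hE comp_lfunE coord_kE.
by rewrite !lfunE -linearN.
Qed.

Lemma lfun_inv_bij : bijective j -> cancel j (j^-1)%VF /\ cancel (j^-1)%VF j.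
Proof.
move=> bj; have jK : cancel j (j^-1)%VF.
  by apply: lker0_lfunK; apply/lker0P; apply: bij_inj.
by split=> //; apply: (bij_can_sym bj _).2.
Qed.

End StructureMaps.

Section Connections.
Variables (K : fieldType) (L : lieAlgType K).
Implicit Types (nabla : {bilinear L -> L -> L}) (S : 'End(L)).

Definition torsion_free nabla :=
  forall X Y, nabla X Y - nabla Y X = [lie X, Y].

Definition flat nabla := forall X Y Z,
  nabla X (nabla Y Z) - nabla Y (nabla X Z) - nabla [lie X, Y] Z = 0.

Definition parallel nabla S := forall X Y, nabla X (S Y) = S (nabla X Y).

Definition tf_parallel nabla S T :=
  [/\ torsion_free nabla, parallel nabla S & parallel nabla T].

Definition integrable_complex S := forall Y Z,
  [lie S Y, S Z] - [lie Y, Z] - S [lie S Y, Z] - S [lie Y, S Z] = 0.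

Definition integrable_product S := forall Y Z,
  [lie S Y, S Z] + [lie Y, Z] - S [lie S Y, Z] - S [lie Y, S Z] = 0.

Definition unique_and_flat (P : {bilinear L -> L -> L} -> Prop) :=
  (forall nabla nabla', P nabla -> P nabla' -> nabla =2 nabla') /\
  (forall nabla, P nabla -> flat nabla).

End Connections.

(* Main.v *)
(* Since E = J F, J = E F and F = E J, a connection that preserves two of the
   three maps preserves all of them.  Each of (4) and (5), evaluated on h x h
   and split along g = h (+) k, says that k is abelian and that
   E [x, y] = [x, E y] + [E x, y] for x, y in h.  A torsion-free connection
   preserving F and E satisfies nabla_x v = [x, v], nabla_x y = E [x, E y] and
   nabla_u = 0 for x, y in h and u, v in k; conversely these formulas define
   such a connection under the two conditions above.  By the Jacobi identity
   its curvature vanishes on k, hence on h = E k because E is parallel. *)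
Require Import Defs.
From HB Require Import structures.
From mathcomp Require Import all_boot all_order all_algebra.
From mathcomp Require Import sesquilinear reals.

Set Implicit Arguments.
Unset Strict Implicit.
Unset Printing Implicit Defensive.

Import GRing.Theory.
Local Open Scope ring_scope.

(** * Consequences of the Lie algebra axioms *)

Section LieBracket.
Variables (K : fieldType) (L : lieAlgType K).
Implicit Types x y z : L.

Lemma lie_antisym x y : [lie x, y] = - [lie y, x].
Proof.
apply/eqP; rewrite -addr_eq0; have := lie_alt (x + y).
by rewrite linearDl /= !linearDr /= !lie_alt add0r addr0 => ->.
Qed.

(** The Jacobi identity in the form that [ad] is a representation; flatness will reduce to it. *)
Lemma lie_leibniz x y z :
  [lie x, [lie y, z]] - [lie y, [lie x, z]] = [lie [lie x, y], z].
Proof.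
have /eqP := lie_jacobi x y z.
rewrite addr_eq0 -(lie_antisym [lie x, y] z) => /eqP <-.
by rewrite (lie_antisym z x) linearNr.
Qed.

End LieBracket.

(** * Endomorphisms parallel for a torsion-free connection *)

Section ParallelStructures.
Variables (K : fieldType) (L : lieAlgType K).
Variable nabla : {bilinear L -> L -> L}.
Implicit Types S T U : 'End(L).

Lemma parallel_comp S T U :
  (forall X, U X = S (T X)) -> parallel nabla S -> parallel nabla T ->
  parallel nabla U.
Proof. by move=> UE pS pT X Y; rewrite !UE pS pT. Qed.

Lemma tf_parallel_integrable_complex S :
  (forall X, S (S X) = - X) -> torsion_free nabla -> parallel nabla S ->
  integrable_complex S.
Proof.
move=> SS tf pS Y Z; rewrite -!tf !linearB /= !pS !SS !opprK !addrA.
(* With brackets replaced by differences of [nabla] and [S] moved outside, the eight terms cancel in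
   these pairs. *)
rewrite (ACl ((1*5)*(2*8)*(3*7)*(4*6))) /=.
by rewrite !(subrr, addNr) !addr0.
Qed.

Lemma tf_parallel_integrable_product S :
  (forall X, S (S X) = X) -> torsion_free nabla -> parallel nabla S ->
  integrable_product S.
Proof.
move=> SS tf pS Y Z; rewrite -!tf !linearB /= !pS !SS !opprK !addrA.
rewrite (ACl ((1*5)*(2*8)*(3*7)*(4*6))) /=.
by rewrite !(subrr, addNr) !addr0.
Qed.

End ParallelStructures.

(** * The splitting of the semidirect product and the algebra of [J], [E], [F] *)

Section SemidirectStructure.
Variables (K : fieldType) (L : lieAlgType K) (h k : {vspace L}).
Variable j : 'Hom(subvs_of h, subvs_of k).
Hypotheses (sd : semidirect_product h k) (bj : bijective j).
Implicit Types x y u v X Y Z : L.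

Local Notation J := (mapJ j).
Local Notation E := (mapE j).
Local Notation F := (mapF h k).
Local Notation P := (daddv_pi h k).
Local Notation Q := (daddv_pi k h).

Let dhk : (h :&: k)%VS = 0%VS. Proof. by case: sd. Qed.
Let dkh : (k :&: h)%VS = 0%VS. Proof. by rewrite capvC. Qed.

Lemma semidirect_split X : P X + Q X = X.
Proof. by apply: daddv_pi_add => //; case: sd => ->; rewrite memvf. Qed.

(** Puts elements in the coordinate form on which [mapJE], [mapEE] and [mapFE] compute. *)
Lemma semidirect_ind (A : L -> Prop) :
  (forall (x : subvs_of h) (v : subvs_of k), A (vsval x + vsval v)) ->
  forall X, A X.
Proof.
move=> AP X; rewrite -(semidirect_split X).
by have := AP (vsproj h (P X)) (vsproj k (Q X)); rewrite !vsprojK ?memv_pi.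
Qed.

Lemma semidirect_add0 x v :
  x \in h -> v \in k -> x + v = 0 -> x = 0 /\ v = 0.
Proof.
move=> xh vk xv0; suff x0 : x = 0 by split=> //; rewrite x0 add0r in xv0.
by rewrite -(linear0 P) -xv0 linearD /= daddv_pi_id // daddv_pi0 // addr0.
Qed.

Lemma mapF_id x : x \in h -> F x = x.
Proof.
move=> xh; have := mapFE dhk (vsproj h x) 0.
by rewrite oppr0 !linear0 !addr0 vsprojK.
Qed.

Lemma mapF_opp v : v \in k -> F v = - v.
Proof.
move=> vk; have := mapFE dhk 0 (vsproj k v).
by rewrite !linear0 !add0r linearN /= vsprojK.
Qed.

Lemma mapE_h x : x \in h -> E x \in k.
Proof.
move=> xh; have := mapEE j dhk (vsproj h x) 0.
by rewrite !linear0 !(add0r, addr0) vsprojK // => ->; apply: subvsP.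
Qed.

Lemma mapE_k v : v \in k -> E v \in h.
Proof.
move=> vk; have := mapEE j dhk 0 (vsproj k v).
by rewrite !linear0 !(add0r, addr0) vsprojK // => ->; apply: subvsP.
Qed.

Lemma mapEK X : E (E X) = X.
Proof.
have [jK jVK] := lfun_inv_bij bj.
by elim/semidirect_ind: X => x v; rewrite !mapEE // jK jVK.
Qed.

Lemma mapJ_EF X : J X = E (F X).
Proof.
by elim/semidirect_ind: X => x v; rewrite mapFE // mapEE // mapJE // !linearN.
Qed.

Lemma mapE_JF X : E X = J (F X).
Proof.
elim/semidirect_ind: X => x v.
by rewrite mapFE // mapEE // mapJE // !linearN /= opprK.
Qed.

Lemma mapF_EJ X : F X = E (J X).
Proof. by rewrite mapJ_EF mapEK. Qed.

Lemma mapJJ X : J (J X) = - X.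
Proof.
have [jK jVK] := lfun_inv_bij bj.
elim/semidirect_ind: X => x v.
by rewrite !mapJE // !linearN /= jK jVK opprD.
Qed.

Lemma tf_parallel_FJ_FE nabla : tf_parallel nabla F J <-> tf_parallel nabla F E.
Proof.
split=> -[tf pF pX]; split=> //.
  exact: parallel_comp mapE_JF pX pF.
exact: parallel_comp mapJ_EF pX pF.
Qed.

Lemma tf_parallel_FE_EJ nabla : tf_parallel nabla F E <-> tf_parallel nabla E J.
Proof.
split=> [[tf pF pE] | [tf pE pJ]]; split=> //.
  exact: parallel_comp mapJ_EF pE pF.
exact: parallel_comp mapF_EJ pE pJ.
Qed.

(** * Structure equations: [k] is abelian and [E] is a 1-cocycle on [h] with values in [k] *)

Definition structure_equations :=
  forall x y, x \in h -> y \in h ->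
    [lie E x, E y] = 0 /\ E [lie x, y] = [lie x, E y] + [lie E x, y].

Let lie_h x y : x \in h -> y \in h -> [lie x, y] \in h.
Proof. by case: sd => _ _ + _; apply. Qed.

Let lie_k X v : v \in k -> [lie X, v] \in k.
Proof. by case: sd => _ _ _; apply. Qed.

Let lie_kl v X : v \in k -> [lie v, X] \in k.
Proof. by move=> vk; rewrite lie_antisym memvN lie_k. Qed.

Lemma integrable_product_structure_equations :
  integrable_product E -> structure_equations.
Proof.
move=> iE x y xh yh; have [Exk Eyk] := (mapE_h xh, mapE_h yh).
have [Exy xEy] := (lie_kl y Exk, lie_k x Eyk).
(* This is the [h]-component of the integrability condition at [x], [y]; the remaining term
   [[lie E x, E y]] is the [k]-component, so both vanish. *)
have h1 : [lie x, y] - E [lie E x, y] - E [lie x, E y] \in h.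
  by rewrite !memvB ?lie_h ?mapE_k.
have [|h0 ->] := semidirect_add0 h1 (lie_k (E x) Eyk).
  by rewrite addrC -(iE x y) !addrA.
split=> //; move: h0; rewrite -addrA -opprD => /eqP.
by rewrite subr_eq0 => /eqP ->; rewrite linearD /= !mapEK addrC.
Qed.

(** [J] is [E] on [h] and [- E] on [k], so for arguments in [h] the condition is that of [E] with
    its [h]-component negated. *)
Lemma integrable_complex_structure_equations :
  integrable_complex J -> structure_equations.
Proof.
move=> iJ x y xh yh; have [Exk Eyk] := (mapE_h xh, mapE_h yh).
have [Exy xEy] := (lie_kl y Exk, lie_k x Eyk).
have h1 : - [lie x, y] + E [lie E x, y] + E [lie x, E y] \in h.
  by rewrite !memvD ?memvN ?lie_h ?mapE_k.
have [|h0 ->] := semidirect_add0 h1 (lie_k (E x) Eyk).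
  have := iJ x y; rewrite !mapJ_EF !(mapF_id xh) !(mapF_id yh).
  rewrite (mapF_opp Exy) (mapF_opp xEy) !linearN /= !opprK => <-.
  by rewrite addrC !addrA.
split=> //; move: h0; rewrite -addrA addrC => /eqP.
by rewrite subr_eq0 => /eqP <-; rewrite linearD /= !mapEK addrC.
Qed.

(** * Existence: the action of [h] on [k], transported to [h] by [E] and extended by zero along
    [k] *)

Definition structure_connection X Y : L :=
  E [lie P X, E (P Y)] + [lie P X, Q Y].

Lemma structure_connection_bilinear :
  bilinear_for *:%R *:%R structure_connection.
Proof.
split=> [Y a X X' | X a Y Y']; rewrite /structure_connection.
  by rewrite !linearP /= !linearPl /= linearP /= scalerDr addrACA.
by rewrite !linearP /= scalerDr addrACA.
Qed.

HB.instance Definition _ :=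
  bilinear_isBilinear.Build K L L L *:%R *:%R structure_connection
    structure_connection_bilinear.

Lemma structure_connection_h X y :
  y \in h -> structure_connection X y = E [lie P X, E y].
Proof.
move=> yh; rewrite /structure_connection (daddv_pi_id dhk yh) (daddv_pi0 dkh yh).
by rewrite linear0r addr0.
Qed.

Lemma structure_connection_k X v :
  v \in k -> structure_connection X v = [lie P X, v].
Proof.
move=> vk; rewrite /structure_connection (daddv_pi0 dhk vk) (daddv_pi_id dkh vk).
by rewrite linear0 linear0r linear0 add0r.
Qed.

(** Only torsion uses the structure equations: the cocycle identity settles [h] against [h],
    commutativity of [k] settles [k] against [k], and mixed pairs agree by construction. *)
Lemma structure_connection_tf_parallel :
  structure_equations -> tf_parallel structure_connection F E.
Proof.
move=> seq; split.
- move=> X Y; rewrite /= /structure_connection.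
  rewrite -[in RHS](semidirect_split X) -[in RHS](semidirect_split Y).
  have := memv_pi h k X; have := memv_pi h k Y.
  have := memv_pi k h X; have := memv_pi k h Y.
  move: (P X) (P Y) (Q X) (Q Y) => x y u v vk uk yh xh.
  have [] := seq (E u) (E v) (mapE_k uk) (mapE_k vk); rewrite !mapEK => uv0 _.
  have [_ /(congr1 E)] := seq x y xh yh; rewrite mapEK linearD /= => xyE.
  rewrite linearDl /= !linearDr /= uv0 addr0 xyE.
  rewrite (lie_antisym u y) (lie_antisym (E x) y) linearN /=.
  by rewrite opprD addrACA !addrA.
- move=> X Y; rewrite -(semidirect_split Y) (linearD F) !linearDr (linearD F) /=.
  have yh := memv_pi h k Y; have vk := memv_pi k h Y.
  rewrite mapF_id // mapF_opp // linearNr /=.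
  rewrite structure_connection_h // structure_connection_k //.
  by rewrite mapF_id ?mapE_k ?lie_k ?mapE_h // mapF_opp ?lie_k.
- move=> X Y; rewrite -(semidirect_split Y) (linearD E) !linearDr (linearD E) /=.
  have yh := memv_pi h k Y; have vk := memv_pi k h Y.
  rewrite [structure_connection X (P Y)]structure_connection_h //.
  rewrite structure_connection_k ?mapE_h // mapEK.
  rewrite structure_connection_h ?mapE_k // mapEK.
  by rewrite structure_connection_k.
Qed.

(** * Uniqueness and flatness, with 2 invertible *)

Hypothesis two_neq0 : 2%:R != 0 :> K.

Let double_eq0 X : X + X = 0 -> X = 0.
Proof.
rewrite -mulr2n -scaler_nat => /eqP.
by rewrite scaler_eq0 (negPf two_neq0) /= => /eqP.
Qed.

(** Comparing [k]-components gives [Q X = - Q X], hence [Q X = 0] as 2 is invertible. *)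
Lemma mapF_fixed X : F X = X -> X \in h.
Proof.
rewrite -{1 2}(semidirect_split X) linearD /= mapF_id ?mapF_opp ?memv_pi //.
move=> /addrI /eqP; rewrite eq_sym -addr_eq0 => /eqP /double_eq0 Q0.
by rewrite -(semidirect_split X) Q0 addr0 memv_pi.
Qed.

Lemma mapF_antifixed X : F X = - X -> X \in k.
Proof.
rewrite -{1 2}(semidirect_split X) linearD /= mapF_id ?mapF_opp ?memv_pi //.
rewrite opprD => /addIr /eqP; rewrite -addr_eq0 => /eqP /double_eq0 P0.
by rewrite -(semidirect_split X) P0 add0r memv_pi.
Qed.

(** Since [F] is parallel, [nabla] preserves its eigenspaces [h] and [k]; torsion then fixes the
    mixed terms, and [E] carries these to the remaining ones. *)
Lemma tf_parallel_structure_connection nabla :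
  tf_parallel nabla F E -> nabla =2 structure_connection.
Proof.
move=> [tf pF pE].
have nh X y : y \in h -> nabla X y \in h.
  by move=> yh; apply: mapF_fixed; rewrite -pF mapF_id.
have nk X v : v \in k -> nabla X v \in k.
  by move=> vk; apply: mapF_antifixed; rewrite -pF mapF_opp // linearN.
have nkh u y : u \in k -> y \in h ->
    nabla u y = 0 /\ nabla y u = [lie y, u].
  (* The torsion identity for [u] and [y], moved to one side, is a sum of an [h]-term and a
     [k]-term. *)
  move=> uk yh; have [||-> /eqP] := semidirect_add0 (nh u y yh)
      (v := - nabla y u + [lie y, u]).
  - by rewrite memvD ?memvN ?lie_k ?nk.
  - by rewrite addrA tf lie_antisym addNr.
  - by rewrite addrC subr_eq0 => /eqP.
have nkk u v : u \in k -> v \in k -> nabla u v = 0.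
  move=> uk vk; rewrite -(mapEK v) pE.
  by rewrite (nkh u (E v) uk (mapE_k vk)).1 linear0.
have nhh x y : x \in h -> y \in h -> nabla x y = E [lie x, E y].
  by move=> xh yh; rewrite -{1}(mapEK y) pE (nkh _ x (mapE_h yh) xh).2.
move=> X Y; rewrite -{1}(semidirect_split X) -{1}(semidirect_split Y).
have [xh yh] := (memv_pi h k X, memv_pi h k Y).
have [uk vk] := (memv_pi k h X, memv_pi k h Y).
rewrite linearDl /= !linearDr /= (nkk _ _ uk vk) (nkh _ _ uk yh).1 !addr0.
by rewrite nhh // (nkh _ _ vk xh).2.
Qed.

Lemma tf_parallel_flat nabla : tf_parallel nabla F E -> flat nabla.
Proof.
move=> tp; have [tf pF pE] := tp; have nE := tf_parallel_structure_connection tp.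
(* As [k] is an ideal, the projection to [h] is a Lie homomorphism. *)
have PB X Y : P [lie X, Y] = [lie P X, P Y].
  rewrite -[in LHS](semidirect_split X) -[in LHS](semidirect_split Y).
  rewrite linearDl /= (linearDr _ (P X)) /= !(linearD P) /=.
  have [xh yh] := (memv_pi h k X, memv_pi h k Y).
  have [uk vk] := (memv_pi k h X, memv_pi k h Y).
  rewrite (daddv_pi_id dhk (lie_h xh yh)) (daddv_pi0 dhk (lie_k _ vk)).
  by rewrite (daddv_pi0 dhk (lie_kl _ uk)) !addr0.
have curv_k X Y v : v \in k ->
    nabla X (nabla Y v) - nabla Y (nabla X v) - nabla [lie X, Y] v = 0.
  move=> vk; rewrite (nE Y v) (nE X v) !nE !structure_connection_k ?lie_k //.
  by rewrite lie_leibniz PB subrr.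
move=> X Y Z; rewrite -(semidirect_split Z).
have := memv_pi h k Z; have := memv_pi k h Z.
move: (P Z) (Q Z) => z w wk zh; rewrite !linearDr /= !opprD.
rewrite !addrA (ACl ((1*3*5)*(2*4*6))) /= (curv_k X Y w wk) addr0.
(* Writing [z] as [E v] with [v] in [k] pulls [E] out of the curvature. *)
rewrite -(mapEK z); move: (E z) (mapE_h zh) => v vk.
by rewrite !pE -!(linearB E) (curv_k X Y v vk) linear0.
Qed.

End SemidirectStructure.

Theorem theorem4p4 (R : realType) (g : lieAlgType R) (h k : {vspace g})
    (j : 'Hom(subvs_of h, subvs_of k)) :
  semidirect_product h k ->
  bijective j ->
  let J := mapJ j in
  let E := mapE j in
  let F := mapF h k in
  [<-> (exists nabla : {bilinear g -> g -> g}, tf_parallel nabla F J);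
       (exists nabla : {bilinear g -> g -> g}, tf_parallel nabla F E);
       (exists nabla : {bilinear g -> g -> g}, tf_parallel nabla E J);
       integrable_complex J;
       integrable_product E] /\
  [/\ unique_and_flat (fun nabla : {bilinear g -> g -> g} => tf_parallel nabla F J),
      unique_and_flat (fun nabla : {bilinear g -> g -> g} => tf_parallel nabla F E) &
      unique_and_flat (fun nabla : {bilinear g -> g -> g} => tf_parallel nabla E J)].
Proof.
move=> sd bj J E F.
have two0 : 2%:R != 0 :> R by rewrite Num.Theory.pnatr_eq0.
have FJ nabla := tf_parallel_FJ_FE j sd nabla.
have EJ nabla := tf_parallel_FE_EJ sd bj nabla.
have ex_FE : structure_equations j -> exists nabla, tf_parallel nabla F E.
  by move=> se; exists (structure_connection j);
    apply: structure_connection_tf_parallel.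
have uf_FE : unique_and_flat (fun nabla : {bilinear g -> g -> g} =>
    tf_parallel nabla F E).
  split=> [nabla nabla' tp tp' X Y | nabla].
    by rewrite !(tf_parallel_structure_connection sd bj two0).
  exact: tf_parallel_flat.
split; last first.
  case: uf_FE => un fl; split; split=> //.
  - by move=> nabla nabla' /FJ tp /FJ; apply: un.
  - by move=> nabla /FJ; apply: fl.
  - by move=> nabla nabla' /EJ tp /EJ; apply: un.
  - by move=> nabla /EJ; apply: fl.
tfae.
- by case=> nabla /FJ tp; exists nabla.
- by case=> nabla /EJ tp; exists nabla.
- case=> nabla [tf _ pJ].
  exact: tf_parallel_integrable_complex (mapJJ sd bj) tf pJ.
(* The passage from [J] to [E] goes through a connection that preserves [F] and [E]. *)
- move=> /(integrable_complex_structure_equations sd bj) /ex_FE[nabla [tf _ pE]].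
  exact: tf_parallel_integrable_product (mapEK sd bj) tf pE.
- move=> /(integrable_product_structure_equations sd bj) /ex_FE[nabla /FJ tp].
  by exists nabla.
Qed.
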